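(* There is a continuous function $\mathcal{G}:\mathrm{PrTr}_2\to\mathbf{K}$ such that for every $T\in\mathrm{PrTr}_2$, $\mathcal{G}(T)$ is the closed offspring of $T$ determined by some compliant family $(D_t)_{t\in T}$, and for every $x\in[T]$: if $x\in\mathcal{N}$ then $\mathcal{O}_{\mathcal{G}(T)}(\overline{x})=1$, and if $x\notin\mathcal{N}$ then $\mathcal{D}_{\mathcal{G}(T)}(\overline{x})\in\{0,1\}$.
   Context: $2^{\omega}$ is the Cantor space; $N_s=\{x\in2^\omega:s\subset x\}$; $\mu$ is the coin-tossing measure, $\mu(N_s)=2^{-\mathrm{lh}(s)}$. For measurable $A$, $\mathcal{D}_A(z)=\lim_n\mu(A\cap N_{z\restriction n})/\mu(N_{z\restriction n})$ when it exists, and $\mathcal{O}_A(z)$ is the limsup minus the liminf of those ratios. $A$ is dualistic if $\mathcal{D}_A(z)$ exists and lies in $\{0,1\}$ for all $z$. $\mathcal{N}=\{y\in2^\omega:y(n)=1\text{ for infinitely many }n\}$. $\mathrm{PrTr}_2$ is the Polish space of pruned trees on $\{0,1\}$ (nonempty, closed under initial segments, every node has a proper extension), as a subspace of $2^{(2^{<\omega})}$; $[T]$ is the set of branches. $\mathbf{K}$ is the space of compact subsets of $2^\omega$ with the Vietoris topology. Stretch: $\overline{s}=s(0)^{(1)}{}^\frown s(1)^{(2)}{}^\frown s(2)^{(3)}\cdots$ ($s(j)$ repeated $j+1$ times). $\mathrm{Fl}(n)=2^{n+1}\setminus\{0^{(n+1)},1^{(n+1)}\}$. A family $(D_t)_{t\in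 T}$ is compliant if each $D_t$ is dualistic, $\emptyset\neq D_t\neq2^\omega$, and $\mu(\operatorname{Int}D_t)=\mu(\operatorname{Cl}D_t)$; its closed offspring is $\{\overline{x}:x\in[T]\}\cup\bigcup\{\overline{t}^\frown a^\frown\operatorname{Cl}D_t:t\in T,\ a\in\mathrm{Fl}(\mathrm{lh}\,t)\}$. *)

(* Defs.v *)
From HB Require Import structures.
From mathcomp Require Import all_boot all_order all_algebra.
From mathcomp Require Import all_classical all_reals all_analysis.
From mathcomp Require Import Rstruct.
Set Implicit Arguments. Unset Strict Implicit. Unset Printing Implicit Defensive.
Import Order.TTheory GRing.Theory Num.Theory.
Local Open Scope classical_set_scope.
Local Open Scope ring_scope.

Notation RR := Rdefinitions.R.

Definition cantor := nat -> bool.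

Definition restr (z : cantor) (n : nat) : seq bool := mkseq z n.

Definition is_prefix (s : seq bool) (x : cantor) : Prop :=
  forall i, (i < size s)%N -> nth false s i = x i.

Definition cyl (s : seq bool) : set cantor := [set x | is_prefix s x].

Definition copen (U : set cantor) : Prop :=
  forall x, U x -> exists n, cyl (restr x n) `<=` U.
Definition cclosed (C : set cantor) : Prop := copen (~` C).
Definition cInt (A : set cantor) : set cantor :=
  [set x | exists n, cyl (restr x n) `<=` A].
Definition cCl (A : set cantor) : set cantor :=
  [set x | forall n, cyl (restr x n) `&` A !=set0].

(* coin-tossing (outer) measure, via covers by basic clopen sets *)
Definition mu (A : set cantor) : \bar RR :=
  ereal_inf [set (\sum_(n <oo) ((2%:R ^- size (c n) : RR)%:E))%E
            | c in [set c : nat -> seq bool | A `<=` \bigcup_n cyl (c n)]].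

Definition mu_measurable (A : set cantor) : Prop :=
  caratheodory_measurable mu A.

Definition dratio (A : set cantor) (z : cantor) (n : nat) : \bar RR :=
  (mu (A `&` cyl (restr z n)) / mu (cyl (restr z n)))%E.

Definition density_is (A : set cantor) (z : cantor) (d : RR) : Prop :=
  (dratio A z @ \oo --> d%:E)%E.

Definition oscillation (A : set cantor) (z : cantor) : \bar RR :=
  (limn_esup (dratio A z) - limn_einf (dratio A z))%E.

Definition dualistic (A : set cantor) : Prop :=
  mu_measurable A /\ forall z, density_is A z 0 \/ density_is A z 1.

Definition Ninf : set cantor := [set y | forall m, exists2 n, (m <= n)%N & y n = true].

Definition pruned_tree (T : set (seq bool)) : Prop :=
  [/\ T !=set0,
      (forall s k, T s -> T (take k s)) &
      (forall s, T s -> exists u, [/\ T u, (size s < size u)%N & s = take (size s) u])].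

Definition branches (T : set (seq bool)) : set cantor :=
  [set x | forall n, T (restr x n)].

(* topology of PrTr_2 as a subspace of 2^(2^<omega), written out:
   W is (relatively) open iff each T in W has a finite-support neighbourhood *)
Definition tree_open (W : set (set (seq bool))) : Prop :=
  forall T, pruned_tree T -> W T ->
    exists F : seq (seq bool), forall T', pruned_tree T' ->
      (forall s, s \in F -> (T' s <-> T s)) -> W T'.

(* continuity into K with the Vietoris topology: preimages of the subbasic
   open sets {K | K ⊆ U} and {K | K ∩ U ≠ ∅} (U open) are open *)
Definition vietoris_continuous (G : set (seq bool) -> set cantor) : Prop :=
  forall U, copen U ->
    tree_open [set T | G T `<=` U] /\ tree_open [set T | G T `&` U !=set0].

Definition stretch (s : seq bool) : seq bool :=
  flatten [seq nseq j.+1 (nth false s j) | j <- iota 0 (size s)].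

Definition stretch_inf (x : cantor) : cantor :=
  fun n => nth false (stretch (restr x n.+1)) n.

Definition prepend (u : seq bool) (y : cantor) : cantor :=
  fun n => if (n < size u)%N then nth false u n else y (n - size u)%N.

Definition Fl (n : nat) : set (seq bool) :=
  [set a | [/\ size a = n.+1, a <> nseq n.+1 false & a <> nseq n.+1 true]].

Definition compliant (T : set (seq bool)) (D : seq bool -> set cantor) : Prop :=
  forall t, T t ->
    [/\ dualistic (D t), D t !=set0, D t <> setT & mu (cInt (D t)) = mu (cCl (D t))].

Definition closed_offspring (T : set (seq bool)) (D : seq bool -> set cantor) : set cantor :=
  (stretch_inf @` branches T) `|`
  [set z | exists t a, [/\ T t, Fl (size t) a &
                         exists2 y, cCl (D t) y & z = prepend (stretch t ++ a) y]].

(* Main.v *)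
(** The tail set attached to a node [t] is clopen and depends on [t] alone: the
    cylinder of [0^(lh t + 1)] or its complement, according to the parity of the
    number of ones in [t].  At a level where the block of [stretch_inf x] for
    [t = restr x k] begins, all but a [2^-k] fraction of the surrounding
    cylinder lies in the cylinders of [stretch t ++ a] with [a] in [Fl k], so
    the density there is within [O(2^-k)] of 0 or 1 depending on that parity.
    The parity along [x] changes infinitely often exactly when [x] is in [Ninf].
    If it is eventually constant, the same estimate at two consecutive blocks
    controls every cylinder in between.  Finally, membership up to a given depth
    is decided by finitely many nodes of the tree, whence continuity. *)
Require Import Defs.
From HB Require Import structures.
From mathcomp Require Import all_boot all_order all_algebra.
From mathcomp Require Import all_classical all_reals all_analysis.
From mathcomp Require Import Rstruct lra.
Set Implicit Arguments. Unset Strict Implicit. Unset Printing Implicit Defensive.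
Import Order.TTheory GRing.Theory Num.Theory.
Local Open Scope classical_set_scope.
Local Open Scope ring_scope.

(** * Finite restrictions and cylinders *)

Lemma size_restr (x : cantor) n : size (restr x n) = n.
Proof. exact: size_mkseq. Qed.

Lemma nth_restr (x : cantor) n i : (i < n)%N -> nth false (restr x n) i = x i.
Proof. exact: nth_mkseq. Qed.

Lemma restrS (x : cantor) n : restr x n.+1 = rcons (restr x n) (x n).
Proof. by rewrite /restr /mkseq -addn1 iotaD map_cat cats1. Qed.

Lemma take_restr (x : cantor) m n : (m <= n)%N -> take m (restr x n) = restr x m.
Proof. by move=> mn; rewrite /restr /mkseq -map_take take_iota (minn_idPl mn). Qed.

Lemma is_prefixE s (x : cantor) : is_prefix s x <-> restr x (size s) = s.
Proof.
split=> [sx|<-].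
  apply: (@eq_from_nth _ false); rewrite size_restr// => i il.
  by rewrite nth_restr// sx.
by move=> i; rewrite size_restr => il; rewrite nth_restr.
Qed.

Lemma cyl_restr (x y : cantor) n :
  cyl (restr x n) y <-> forall i, (i < n)%N -> y i = x i.
Proof.
rewrite /cyl /= /is_prefix size_restr; split=> h i il; have := h i il.
  by rewrite nth_restr.
by move=> ->; rewrite nth_restr.
Qed.

Lemma cyl_restrE (x y : cantor) n : cyl (restr x n) y -> restr y n = restr x n.
Proof. by move/is_prefixE; rewrite size_restr. Qed.

Lemma cyl_rcons s b (x : cantor) :
  cyl (rcons s b) x <-> cyl s x /\ x (size s) = b.
Proof.
rewrite /cyl /=; rewrite !is_prefixE size_rcons restrS; split.
  by move=> /rcons_inj[-> ->].
by case=> -> ->.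
Qed.

Lemma cyl_split s : cyl s = cyl (rcons s false) `|` cyl (rcons s true).
Proof.
apply/seteqP; split=> x.
  by move=> sx; case E: (x (size s)); [right|left]; apply/cyl_rcons.
by case=> /cyl_rcons[].
Qed.

Lemma cyl_shift s (x : cantor) k v : size s = k ->
  cyl (s ++ v) x <-> cyl s x /\ cyl v (fun i => x (k + i)%N).
Proof.
move=> <-; rewrite /cyl /= /is_prefix size_cat; split=> [h|[h1 h2] i il].
  split=> i il.
    by have := h i; rewrite nth_cat il; apply; rewrite (leq_trans il)// leq_addr.
  have := h (size s + i)%N; rewrite ltn_add2l nth_cat => /(_ il).
  by rewrite ifF ?addKn// ltnNge leq_addr.
rewrite nth_cat; case: ltnP => [|si]; first exact: h1.
by have := h2 (i - size s)%N; rewrite subnKC//; apply; rewrite ltn_subLR.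
Qed.

(** Choose a good bit for every word and iterate from [s]; the nested words converge to [x]. All
    compactness arguments below go through this descent. *)
Lemma branch_exists (P : seq bool -> Prop) s : P s ->
  (forall u, P u -> P (rcons u false) \/ P (rcons u true)) ->
  exists x : cantor, cyl s x /\ forall n, (size s <= n)%N -> P (restr x n).
Proof.
move=> Ps step.
have [f fP] : {f : seq bool -> bool & forall u, P u -> P (rcons u (f u))}.
  apply: (@choice _ _ (fun u b => P u -> P (rcons u b))) => u.
  have [Pu|nPu] := pselect (P u); last by exists true.
  by have [|] := step _ Pu; [exists false|exists true].
pose g n := iter n (fun u => rcons u (f u)) s.
have sg n : size (g n) = (size s + n)%N.
  by elim: n => [|n IH]; rewrite ?addn0//= size_rcons IH addnS.
have Pg n : P (g n) by elim: n => [|n IH] //=; exact: fP.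
have gh n m i : (i < size (g n))%N -> nth false (g (m + n)%N) i = nth false (g n) i.
  move=> il; elim: m => [|m IH]//; rewrite addSn /= nth_rcons IH.
  by rewrite (leq_trans il)// !sg leq_add2l leq_addl.
pose x i := nth false (g i.+1) i.
have xg n : cyl (g n) x.
  move=> i il; rewrite /x.
  have ii : (i < size (g i.+1))%N by rewrite sg leq_addl.
  case/orP: (leq_total n i.+1) => ni.
    by rewrite -(gh _ (i.+1 - n)%N i il) subnK.
  by rewrite -(gh _ (n - i.+1)%N i ii) subnK.
exists x; split; first exact: (xg 0%N).
move=> n sn; suff -> : restr x n = g (n - size s)%N by [].
by have /is_prefixE := xg (n - size s)%N; rewrite sg subnKC.
Qed.

(** * Cylinder weights and the coin-tossing outer measure *)

Definition wt (s : seq bool) : RR := 2%:R ^- size s.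

Lemma wt_gt0 s : 0 < wt s.
Proof. by rewrite /wt invr_gt0 exprn_gt0. Qed.

Lemma wt_rcons s b : wt (rcons s b) = wt s / 2.
Proof. by rewrite /wt size_rcons exprS invfM mulrC. Qed.

Lemma wt_cat u v : wt (u ++ v) = wt u * wt v.
Proof. by rewrite /wt size_cat exprD invfM. Qed.

(* [overlap c s] is the measure of [cyl c `&` cyl s]. *)
Fixpoint overlap (c s : seq bool) : RR :=
  match c, s with
  | [::], _ => wt s
  | _, [::] => wt c
  | a :: c', b :: s' => if a == b then overlap c' s' / 2 else 0
  end.

Lemma wt_cons b s : wt (b :: s) = wt s / 2.
Proof. by rewrite /wt /= exprS invfM mulrC. Qed.

Lemma overlap_ge0 c s : 0 <= overlap c s.
Proof.
elim: c s => [|a c IH] [|b s] /=; try exact/ltW/wt_gt0.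
by case: ifP => // _; rewrite divr_ge0.
Qed.

Lemma overlap_le c s : overlap c s <= wt c.
Proof.
elim: c s => [|a c IH] [|b s] //=.
  by rewrite /wt expr0 invr1 invf_le1 ?exprn_gt0// exprn_ege1// ler1n.
case: ifP => _; last by rewrite ltW// wt_gt0.
by rewrite wt_cons ler_pM2r ?IH// invr_gt0.
Qed.

(** Conservation of mass under halving: it lets an underweight cover of a cylinder stay underweight
    on one of the halves. *)
Lemma overlap_split c s :
  overlap c s = overlap c (rcons s false) + overlap c (rcons s true).
Proof.
elim: c s => [|a c IH] s /=; first by rewrite !wt_rcons -splitr.
case: s => [|b s] /=; last first.
  by case: ifP => _; rewrite ?addr0// IH mulrDl.
have ov0 : overlap c [::] = wt c by case: (c).
by case: a => /=; rewrite ov0 wt_cons ?addr0 ?add0r.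
Qed.

Lemma overlap_prefix c v : overlap c (c ++ v) = wt (c ++ v).
Proof. by elim: c => [|a c IH] //=; rewrite eqxx IH wt_cons. Qed.

Local Open Scope ereal_scope.

Lemma mu_le_cover (A : set cantor) (c : nat -> seq bool) :
  A `<=` \bigcup_n cyl (c n) -> mu A <= \sum_(n <oo) (wt (c n))%:E.
Proof. by move=> Ac; apply: ereal_inf_lbound; exists c. Qed.

Lemma wt_ge0 s : 0%E <= (wt s)%:E.
Proof. by rewrite lee_fin ltW// wt_gt0. Qed.

Lemma mu_ge0 A : 0 <= mu A.
Proof.
by apply: le_ereal_inf_tmp => _ [c _ <-]; apply: nneseries_ge0 => n _ _; exact: wt_ge0.
Qed.

Lemma le_mu : {homo mu : A B / A `<=` B >-> A <= B}.
Proof.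
move=> A B AB; apply: le_ereal_inf_tmp => _ [c Bc <-].
by apply: mu_le_cover; exact: subset_trans Bc.
Qed.

(** Covers are infinite sequences of nonempty cylinders, so a finite cover has to be padded; this
    padding costs at most [2^-m]. *)
Lemma sum_wt_tiny m :
  \sum_(n <oo) (wt (nseq (m + n.+1) false))%:E <= (2%:R ^- m : RR)%:E.
Proof.
apply: le_trans (epsilon_trick0 xpredT _); last first.
  by rewrite invr_ge0 exprn_ge0.
apply: lee_nneseries => n *; first exact: wt_ge0.
by rewrite lee_fin /wt size_nseq exprD invfM natrX.
Qed.

Lemma le_exp2N (r : RR) : (0 < r)%R -> exists m, (2%:R ^- m <= r)%R.
Proof.
move=> r0; exists (Num.truncn r^-1).+1.
rewrite -[leRHS]invrK lef_pV2 ?posrE ?invr_gt0 ?exprn_gt0//.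
rewrite -natrX (le_trans (ltW (truncnS_gt _)))// ler_nat.
exact/ltnW/ltn_expl.
Qed.

Lemma le_add_exp2N (x y : \bar RR) :
  (forall m, x <= y + (2%:R ^- m : RR)%:E) -> x <= y.
Proof.
move=> h; apply/lee_addgt0Pr => e e0; have [m me] := le_exp2N e0.
by rewrite (le_trans (h m))// leeD2l// lee_fin.
Qed.

Lemma mu0 : mu set0 = 0.
Proof.
apply/eqP; rewrite eq_le mu_ge0 andbT; apply: le_add_exp2N => m.
by rewrite add0e (le_trans _ (sum_wt_tiny m))// mu_le_cover.
Qed.

Lemma mu_cyl_le s : mu (cyl s) <= (wt s)%:E.
Proof.
apply: le_add_exp2N => m.
pose c n := if n is k.+1 then nseq (m + k.+1) false else s.
have /mu_le_cover/le_trans : cyl s `<=` \bigcup_n cyl (c n) by move=> x; exists 0%N.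
apply; have c0 n : 0 <= (wt (c n))%:E by exact: wt_ge0.
rewrite nneseries_recl// leeD2l// (le_trans _ (sum_wt_tiny m))//.
by rewrite -(nneseries_addn 1)//; apply: lee_nneseries => // n _; rewrite addn1.
Qed.

(** Take a cover of each [A n] that is optimal up to [e / 2^(n+1)] and merge all of them along a
    bijection of [nat] with [nat * nat]. *)
Lemma mu_sigma_subadditive : sigma_subadditive mu.
Proof.
move=> A; apply/lee_addgt0Pr => e e0.
apply: le_trans (epsilon_trick xpredT (fun n => mu_ge0 (A n)) (ltW e0)).
have [c cP] : {c : nat -> nat -> seq bool & forall n,
    mu (A n) = +oo \/ (A n `<=` \bigcup_k cyl (c n k) /\
    \sum_(k <oo) (wt (c n k))%:E <= mu (A n) + (e / (2 ^ n.+1)%:R)%:E)}.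
  apply: (@choice _ _ (fun n b => mu (A n) = +oo \/ (A n `<=` \bigcup_k cyl (b k) /\
    \sum_(k <oo) (wt (b k))%:E <= mu (A n) + (e / (2 ^ n.+1)%:R)%:E))) => n.
  have [->|oo] := eqVneq (mu (A n)) +oo; first by exists (fun=> [::]); left.
  have fin : mu (A n) \is a fin_num by rewrite ge0_fin_numE ?mu_ge0// ltey.
  have en : (0 < e / (2 ^ n.+1)%:R)%R by rewrite divr_gt0// ltr0n expn_gt0.
  have [_ [b Ab <-] bl] := lb_ereal_inf_adherent en fin.
  by exists b; right; split=> //; exact: ltW.
have [[i ioo]|noo] := pselect (exists i, mu (A i) = +oo).
  rewrite [leRHS](eseries_pinfty (k := i)) ?leey// => [n _|]; last by rewrite ioo.
  by rewrite -ltNye (@lt_le_trans _ _ 0)// adde_ge0 ?mu_ge0// lee_fin divr_ge0 ?ltW.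
have {}cP n : A n `<=` \bigcup_k cyl (c n k) /\
    \sum_(k <oo) (wt (c n k))%:E <= mu (A n) + (e / (2 ^ n.+1)%:R)%:E.
  by case: (cP n) => // oo; exfalso; apply: noo; exists n.
apply: (@le_trans _ _ (\sum_(n <oo) \sum_(k <oo) (wt (c n k))%:E)); last first.
  apply: lee_nneseries => n *; last exact: (cP n).2.
  by apply: nneseries_ge0 => *; exact: wt_ge0.
have /card_esym/ppcard_eqP[f] := card_nat2.
have -> : \sum_(n <oo) \sum_(k <oo) (wt (c n k))%:E =
    \sum_(m <oo) (wt (c (f m).1 (f m).2))%:E.
  rewrite nneseries_esumT; last first.
    by move=> n; apply: nneseries_ge0 => *; exact: wt_ge0.
  rewrite (eq_esum (b := fun n => \esum_(k in setT) (wt (c n k))%:E)); last first.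
    by move=> n _; rewrite nneseries_esumT// => k; exact: wt_ge0.
  rewrite esum_esum; last by move=> *; exact: wt_ge0.
  rewrite (_ : _ `*`` _ = setT); last by apply/seteqP; split.
  rewrite nneseries_esumT; last by move=> n; exact: wt_ge0.
  by rewrite (reindex_esum [set: nat] _ f)//; exact: bij.
apply: (mu_le_cover (c := fun m => c (f m).1 (f m).2)) => x [n _ /(cP n).1[k _ xk]].
by exists (f^-1%FUN (n, k)) => //=; rewrite invK ?inE.
Qed.

HB.instance Definition _ := isOuterMeasure.Build RR cantor mu
  mu0 mu_ge0 le_mu mu_sigma_subadditive.

Lemma le_muU A B : mu (A `|` B) <= mu A + mu B.
Proof. exact: outer_measureU2. Qed.

(* A cylinder of which a cover misses mass has a half with the same property,
   so an underweight cover of [cyl s] misses some point of [cyl s]. *)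
Lemma mu_cyl s : mu (cyl s) = (wt s)%:E.
Proof.
apply/eqP; rewrite eq_le mu_cyl_le/=; apply: le_ereal_inf_tmp => _ [c sc <-].
rewrite leNgt; apply/negP => clt.
pose P u := \sum_(n <oo) (overlap (c n) u)%:E < (wt u)%:E.
have ov0 n u : 0 <= (overlap (c n) u)%:E by rewrite lee_fin overlap_ge0.
have [||x [sx Px]] := @branch_exists P s.
- apply: le_lt_trans clt; apply: lee_nneseries => // n _.
  by rewrite lee_fin overlap_le.
- move=> u; rewrite /P => Pu.
  case: ltP => h0; [by left|right]; rewrite ltNge; apply/negP => h1.
  move: Pu; apply/negP; rewrite -leNgt.
  under eq_eseriesr do rewrite overlap_split EFinD.
  rewrite nneseriesD//; apply: le_trans (leeD h0 h1).
  by rewrite -EFinD lee_fin !wt_rcons -splitr.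
have [n _ nx] := sc _ sx.
(* Once the prefix of [x] is as long as [c n], the overlap with [c n] alone is the full weight of
   the prefix, against [Px]. *)
have := Px (maxn (size s) (size (c n))) (leq_maxl _ _).
apply/negP; rewrite -leNgt (@nneseriesD1 _ _ n)// -[leLHS]adde0.
rewrite leeD//; last by apply: nneseries_ge0 => *; exact: ov0.
have := take_restr x (leq_maxr (size s) (size (c n))).
move/is_prefixE: nx => -> h; rewrite lee_fin.
by rewrite -(cat_take_drop (size (c n)) (restr x _)) h overlap_prefix.
Qed.

Lemma mu_half (A : set cantor) u (r : RR) :
  (forall b, mu (A `&` cyl (rcons u b)) <= (r / 2)%:E) -> mu (A `&` cyl u) <= r%:E.
Proof.
move=> h; rewrite cyl_split setIUr (le_trans (le_muU _ _))//.
by rewrite [r]splitr EFinD leeD.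
Qed.

(** * Clopen sets, with a depth that decides membership *)

Definition finite_depth (N : nat) (A : set cantor) :=
  forall x y, A x -> cyl (restr x N) y -> A y.

Lemma finite_depthC N A : finite_depth N A -> finite_depth N (~` A).
Proof.
move=> h x y nAx xy Ay; apply: nAx; apply: h Ay _.
by apply/cyl_restr => i iN; have /cyl_restr -> := xy.
Qed.

Lemma finite_depth_cyl s : finite_depth (size s) (cyl s).
Proof. by move=> x y /is_prefixE <-; rewrite size_restr. Qed.

Lemma finite_depth_cap N A u : finite_depth N A -> (N <= size u)%N ->
  cyl u `<=` A \/ A `&` cyl u = set0.
Proof.
move=> fA Nu; have [[x [Ax ux]]|h] := pselect (exists x, A x /\ cyl u x).
  left=> y uy; apply: fA Ax _; apply/cyl_restr => i iN.
  by rewrite -(ux i) ?(uy i)// (leq_trans iN).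
by right; apply/seteqP; split=> // x [Ax ux]; apply: h; exists x.
Qed.

(** A cylinder is cut without loss of mass: halve it down to depth [N], where each part is inside
    [A] or disjoint from it. For an arbitrary [X], cut each cylinder of a cover in this way. *)
Lemma finite_depth_measurable N A : finite_depth N A -> mu_measurable A.
Proof.
move=> fA.
have cylA u : mu (cyl u `&` A) + mu (cyl u `&` ~` A) <= (wt u)%:E.
  elim: {u}(N - size u)%N {-2}u (leqnn (N - size u)) => [|m IH] u um.
    move: um; rewrite leqn0 subn_eq0 => /(finite_depth_cap fA)[uA|uA].
      have -> : cyl u `&` ~` A = set0 by apply/seteqP; split=> // x [/uA Ax []].
      by rewrite outer_measure0 adde0 (le_trans _ (mu_cyl_le u))// le_mu.
    by rewrite setIC uA outer_measure0 add0e (le_trans _ (mu_cyl_le u))// le_mu.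
  rewrite cyl_split !setIUl (le_trans (leeD (le_muU _ _) (le_muU _ _)))//.
  rewrite addeACA [leRHS](_ : _ = (wt (rcons u false))%:E + (wt (rcons u true))%:E).
    by rewrite leeD// IH// size_rcons; rewrite leq_subLR addSnnS -leq_subLR.
  by rewrite -EFinD !wt_rcons -splitr.
apply: le_caratheodory_measurable => X.
apply: le_ereal_inf_tmp => _ [c Xc <-].
have sub B : mu (X `&` B) <= \sum_(n <oo) mu (cyl (c n) `&` B).
  apply: le_trans (mu_sigma_subadditive _); apply: le_mu.
  by rewrite -setI_bigcupl; apply: setSI.
apply: le_trans (leeD (sub A) (sub (~` A))) _.
rewrite -nneseriesD//; [|by move=> *; exact: mu_ge0|by move=> *; exact: mu_ge0].
apply: lee_nneseries => [n _ _|n _]; last exact: cylA.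
by rewrite adde_ge0// mu_ge0.
Qed.

Local Close Scope ereal_scope.
Local Open Scope nat_scope.

(** * Compactness, and branches of pruned trees *)

Lemma mem_cyl_restr (x : cantor) n : cyl (restr x n) x.
Proof. by apply/cyl_restr. Qed.

(** A Lebesgue number for [K] inside [U]. If every depth fails, descend through cylinders in which
    every depth still fails; the limit point is in [K] because [K] is closed, yet a neighbourhood of
    it lies in [U]. *)
Lemma closed_sub_open_depth K U : cclosed K -> copen U -> K `<=` U ->
  exists N, forall z, K z -> cyl (restr z N) `<=` U.
Proof.
move=> cK oU KU; apply: contrapT => noN.
pose P s := forall N, exists z, [/\ K z, cyl s z & ~ cyl (restr z N) `<=` U].
have P0 : P [::].
  move=> N; apply: contrapT => h; apply: noN; exists N => z Kz.
  by apply: contrapT => zU; apply: h; exists z; split.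
have [u Pu|x [_ Px]] := branch_exists P0.
  (* If the halves stop failing at depths [M] and [N], a point of [cyl u] failing at the larger
     depth also fails at both, and it lies in one of the halves. *)
  apply: contrapT => /not_orP[/existsNP[M hM] /existsNP[N hN]].
  have [z [Kz uz zU]] := Pu (maxn M N).
  have mono m : m <= maxn M N -> ~ cyl (restr z m) `<=` U.
    move=> le_m mU; apply: zU => y /cyl_restr zy; apply: mU; apply/cyl_restr => i im.
    by apply: zy; exact: leq_trans le_m.
  case E : (z (size u)).
    apply: hN; exists z; split=> //; first exact/cyl_rcons.
    exact/mono/leq_maxr.
  apply: hM; exists z; split=> //; first exact/cyl_rcons.
  exact/mono/leq_maxl.
have Kx : K x.
  apply: contrapT => /cK[n nK].
  by have [z [Kz xz _]] := Px n (leq0n _) n; exact: nK xz Kz.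
have [n nU] := oU x (KU x Kx).
have [z [Kz xz]] := Px n (leq0n _) n.
by apply; rewrite (cyl_restrE xz).
Qed.

Lemma pruned_branch T t : pruned_tree T -> T t ->
  exists x, branches T x /\ cyl t x.
Proof.
move=> [_ sT pT] Tt.
have [u Tu|x [tx Tx]] := @branch_exists T t Tt.
  have [v [Tv uv uE]] := pT u Tu.
  have := sT v (size u).+1 Tv; rewrite (take_nth false uv) -uE.
  by case: nth; [right|left].
exists x; split=> // n; have := sT _ n (Tx _ (leq_maxl (size t) n)).
by rewrite take_restr// leq_maxr.
Qed.

(** * Blocks of a stretched sequence *)

(** The triangular number [k(k+1)/2]: block [k] of a stretch occupies the positions from [tri k] to
    [tri k + k]. *)
Fixpoint tri k := if k is j.+1 then tri j + k else 0.

Lemma leq_tri k : k <= tri k.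
Proof. by case: k => //= k; exact: leq_addl. Qed.

Lemma leq_triS i k : i < k -> tri i.+1 <= tri k.
Proof.
elim: k => // k IH; rewrite ltnS leq_eqVlt => /orP[/eqP->//|/IH h].
by rewrite (leq_trans h)//= leq_addr.
Qed.

Lemma ltn_tri_block k j : j <= k -> tri k + j < tri k.+1.
Proof. by move=> jk; rewrite /= ltn_add2l ltnS. Qed.

Lemma tri_block n : exists k j, j <= k /\ n = tri k + j.
Proof.
elim: n => [|n [k [j [jk ->]]]]; first by exists 0, 0.
case: (ltnP j k) => h; first by exists k, j.+1; rewrite addnS.
exists k.+1, 0; split => //=; rewrite addn0 addnS.
by congr (_ + _).+1; apply/eqP; rewrite eqn_leq jk.
Qed.

Lemma stretch_rcons t b : stretch (rcons t b) = stretch t ++ nseq (size t).+1 b.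
Proof.
rewrite /stretch size_rcons -addn1 iotaD map_cat flatten_cat /= cats0 add0n.
rewrite nth_rcons ltnn eqxx; congr (flatten _ ++ _); last by rewrite addn1.
apply/eq_in_map => j; rewrite mem_iota add0n => /andP[_ jt].
by rewrite nth_rcons jt.
Qed.

Lemma size_stretch t : size (stretch t) = tri (size t).
Proof.
elim/last_ind: t => // t b IH.
by rewrite stretch_rcons size_cat IH size_nseq size_rcons.
Qed.

Lemma cyl_nseq n b (z : cantor) : cyl (nseq n b) z <-> forall i, i < n -> z i = b.
Proof.
rewrite /cyl /= /is_prefix size_nseq.
by split=> h i il; have := h i il; rewrite nth_nseq il.
Qed.

Lemma cyl_stretch t (z : cantor) :
  cyl (stretch t) z <->
  forall k j, k < size t -> j <= k -> z (tri k + j) = nth false t k.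
Proof.
elim/last_ind: t => [|t b IH]; first by split.
rewrite stretch_rcons (cyl_shift _ _ (size_stretch t)) IH cyl_nseq size_rcons; split.
  move=> [h1 h2] k j; rewrite ltnS nth_rcons leq_eqVlt.
  by case: eqP => [-> _ jk|_ /= kt jk]; rewrite ?ltnn ?kt; [exact: h2|exact: h1].
move=> h; split=> [k j kt jk|j jt].
  by rewrite h ?nth_rcons ?kt//; exact: leqW.
by rewrite h// nth_rcons ltnn eqxx.
Qed.

Lemma stretch_infE x k j : j <= k -> stretch_inf x (tri k + j) = x k.
Proof.
move=> jk; rewrite /stretch_inf; set n := tri k + j.
have /cyl_stretch/(_ k j) : cyl (stretch (restr x n.+1)) (nth false (stretch (restr x n.+1))).
  by [].
have kn : k < n.+1 by rewrite ltnS (leq_trans (leq_tri k))// leq_addr.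
by rewrite size_restr => ->//; rewrite nth_restr.
Qed.

Lemma restr_stretch_inf x k : restr (stretch_inf x) (tri k) = stretch (restr x k).
Proof.
have : cyl (stretch (restr x k)) (stretch_inf x).
  by apply/cyl_stretch => i j; rewrite size_restr => ik ji; rewrite stretch_infE ?nth_restr.
by move/is_prefixE; rewrite size_stretch size_restr.
Qed.

(** * The offspring read block by block *)

Definition const_block (z : cantor) k := forall j, j <= k -> z (tri k + j) = z (tri k).

(** A left inverse of [stretch_inf]. *)
Definition heads (z : cantor) : cantor := fun i => z (tri i).

Definition drop_inf n (z : cantor) : cantor := fun i => z (n + i).

Lemma cyl_stretch_const t z : cyl (stretch t) z ->
  (forall i, i < size t -> const_block z i) /\ restr (heads z) (size t) = t.
Proof.
move/cyl_stretch => h; have h0 i : i < size t -> z (tri i) = nth false t i.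
  by move=> it; rewrite -(h i 0)// addn0.
split=> [i it j ji|]; first by rewrite h0// h.
by apply/is_prefixE => i it; rewrite /heads h0.
Qed.

Lemma const_cyl_stretch k z : (forall i, i < k -> const_block z i) ->
  cyl (stretch (restr (heads z) k)) z.
Proof.
move=> h; apply/cyl_stretch => i j; rewrite size_restr => ik ji.
by rewrite nth_restr// h.
Qed.

(* Reading [z] block by block: at the first non-constant block [k], the heads
   of the earlier blocks are a node [t] of [T], block [k] is some
   [a] in [Fl (size t)], and what follows belongs to [D t]. *)
Definition offspring (T : set (seq bool)) (D : seq bool -> set cantor) : set cantor :=
  [set z | forall k, (forall i, i < k -> const_block z i) ->
     T (restr (heads z) k) /\
     (~ const_block z k -> D (restr (heads z) k) (drop_inf (tri k.+1) z))].

Lemma prepend_drop u z : cyl u z -> prepend u (drop_inf (size u) z) = z.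
Proof.
move=> uz; apply/funext => n; rewrite /prepend /drop_inf.
by case: ltnP => h; [exact: uz|rewrite subnKC].
Qed.

Lemma cyl_prepend u y : cyl u (prepend u y).
Proof. by move=> i iu; rewrite /prepend iu. Qed.

Lemma drop_prepend u y n : n = size u -> drop_inf n (prepend u y) = y.
Proof.
move=> ->; apply/funext => i; rewrite /prepend /drop_inf.
by rewrite ltnNge leq_addr /= addKn.
Qed.

Lemma first_nonconst (z : cantor) : (forall k, const_block z k) \/
  exists k, (forall i, i < k -> const_block z i) /\ ~ const_block z k.
Proof.
have [h|h] := pselect (exists k, `[<~ const_block z k>]); last first.
  by left=> k; apply: contrapT => zk; apply: h; exists k; exact/asboolP.
right; have /asboolP nk := xchooseP h.
case: (ex_minnP h) => k /asboolP zk kmin; exists k; split=> // i ik.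
by apply: contrapT => /asboolP/kmin; rewrite leqNgt ik.
Qed.

Lemma offspring_branch T D x : branches T x -> offspring T D (stretch_inf x).
Proof.
move=> Tx k _; have -> : heads (stretch_inf x) = x.
  by apply/funext => i; rewrite /heads -[tri i]addn0 stretch_infE.
split=> [|[] j jk]; first exact: Tx.
by rewrite stretch_infE// -[tri k]addn0 stretch_infE.
Qed.

Lemma offspring_node T D t z :
  (forall s k, T s -> T (take k s)) -> T t -> cyl (stretch t) z ->
  ~ const_block z (size t) ->
  offspring T D z <-> D t (drop_inf (tri (size t).+1) z).
Proof.
move=> sT Tt tz nz; have [tconst tE] := cyl_stretch_const tz.
split=> [/(_ _ tconst)[_ /(_ nz)]|Dz k hk]; first by rewrite tE.
(* Block [size t] is not constant, so no condition of [offspring] beyond it is active; those before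
   it only ask for initial segments of [t] in [T]. *)
have kt : k <= size t by rewrite leqNgt; apply/negP => /hk.
split; first by rewrite -(take_restr _ kt) tE; exact: sT.
by move: kt; rewrite leq_eqVlt => /orP[/eqP -> _|/tconst//]; rewrite tE.
Qed.

(** The two parts of the union correspond to the sequences with all blocks constant, which are the
    stretches of their heads, and to those with a first non-constant block, which is the word [a] in
    [Fl]. *)
Lemma offspringE T D : pruned_tree T -> (forall t, cCl (D t) = D t) ->
  closed_offspring T D = offspring T D.
Proof.
move=> [_ sT _] clD; apply/seteqP; split=> z.
  case=> [[x Tx <-]|[t [a [Tt [sa a0 a1] [y]]]]]; first exact: offspring_branch.
  rewrite clD => Dy zE.
  have : cyl (stretch t ++ a) z by rewrite zE; exact: cyl_prepend.
  move/(cyl_shift _ _ (size_stretch t)) => [tz az].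
  have nconst : ~ const_block z (size t).
    move=> cz; have aE : a = nseq (size t).+1 (z (tri (size t))).
      apply: (@eq_from_nth _ false); rewrite ?size_nseq// => i ia.
      by rewrite nth_nseq -sa ia az// cz// -ltnS -sa.
    by move: aE; case: (z _).
  apply/(offspring_node D sT Tt tz nconst).
  by rewrite zE drop_prepend// size_cat size_stretch sa.
move=> hz; have [cz|[k [hk nk]]] := first_nonconst z.
  left; exists (heads z) => [n|]; first by apply: (hz n _).1 => i _; exact: cz.
  apply/funext => n; have [k [j [jk ->]]] := tri_block n.
  by rewrite stretch_infE// cz.
right; have [Tt /(_ nk) Dt] := hz k hk.
pose a := restr (drop_inf (tri k) z) k.+1.
have sa : size a = k.+1 by rewrite size_restr.
exists (restr (heads z) k), a; split=> //.
  have na b : a <> nseq k.+1 b.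
    move=> aE; apply: nk => j jk.
    have h i : i <= k -> z (tri k + i) = b.
      move=> ik; have := congr1 (fun s => nth false s i) aE.
      by rewrite nth_nseq ltnS ik nth_restr.
    by rewrite h// -[tri k]addn0 h.
  by rewrite size_restr; split.
exists (drop_inf (tri k.+1) z); first by rewrite clD.
have <- : size (stretch (restr (heads z) k) ++ a) = tri k.+1.
  by rewrite size_cat size_stretch size_restr sa.
rewrite prepend_drop//; apply/cyl_shift; first by rewrite size_stretch size_restr.
by split; [exact: const_cyl_stretch|exact: mem_cyl_restr].
Qed.

(** * Closedness and continuity *)

Lemma const_block_agree z w k n : tri k.+1 <= n -> cyl (restr z n) w ->
  forall i, i <= k -> const_block z i -> const_block w i.
Proof.
move=> kn /cyl_restr zw i ik iz j ji.
have lt l : l <= i -> tri i + l < n.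
  move=> li; apply: leq_trans kn; apply: leq_trans (ltn_tri_block li) _.
  exact: leq_triS.
by have := lt 0 isT; rewrite addn0 => lt0; rewrite !zw ?iz ?lt.
Qed.

Lemma cyl_restr_sym z w n : cyl (restr z n) w -> cyl (restr w n) z.
Proof. by move=> /cyl_restr zw; apply/cyl_restr => i il; rewrite zw. Qed.

Lemma heads_agree z w k n : tri k <= n -> cyl (restr z n) w ->
  restr (heads w) k = restr (heads z) k.
Proof.
move=> kn /cyl_restr zw; apply: cyl_restrE; apply/cyl_restr => i ik.
apply: zw; apply: leq_trans kn; apply: leq_trans (leq_triS ik).
by rewrite -[tri i]addn0; exact: ltn_tri_block.
Qed.

Lemma offspring_closed T D : (forall t, finite_depth (size t).+1 (D t)) ->
  cclosed (offspring T D).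
Proof.
move=> fD z /existsNP[k /not_implyP[hk nk]].
(* A failure at [k] is visible after blocks [0] to [k] and the [k + 1] further bits that decide
   membership in the tail set. *)
set n := tri k.+1 + k.+1; exists n => w zw wT; apply: nk.
have kn : tri k.+1 <= n by exact: leq_addr.
have wz := cyl_restr_sym zw.
have kn' : tri k <= n by rewrite (leq_trans _ kn)//= leq_addr.
have [|] := wT k; first by move=> i ik; apply: const_block_agree zw _ (ltnW ik) (hk i ik).
rewrite (heads_agree kn' zw) => Tz Dz; split=> // nz.
have /Dz Dw : ~ const_block w k by move=> wk; apply: nz; exact: const_block_agree kn wz _ _ wk.
apply: (fD _ _ _ Dw); apply/cyl_restr => i; rewrite size_restr => ik.
by rewrite /drop_inf; apply: (cyl_restr _ _ _).1 wz _ _; rewrite /n ltn_add2l.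
Qed.

(** If the first [M] blocks of [z] are constant, their heads form a node of [T'], and a stretched
    branch of [T'] through it is close to [z]. Otherwise only nodes of length at most [M] are
    consulted and [z] itself serves. *)
Lemma offspring_approx T T' D M z : pruned_tree T' ->
  (forall s, size s <= M -> T s -> T' s) -> offspring T D z ->
  exists2 z', offspring T' D z' & cyl (restr z M) z'.
Proof.
move=> pT' TT' zT; have [hM|] := pselect (forall i, i < M -> const_block z i).
  have [TM _] := zT M hM.
  have [|x [T'x]] := pruned_branch (t := restr (heads z) M) pT'.
    by apply: TT' TM; rewrite size_restr.
  move=> /cyl_restr tx; exists (stretch_inf x); first exact: offspring_branch.
  apply/cyl_restr => n; have [k [j [jk ->]]] := tri_block n => nM.
  have kM : k < M by rewrite (leq_ltn_trans _ nM)// (leq_trans (leq_tri k))// leq_addr.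
  by rewrite stretch_infE// tx// hM.
move=> /existsNP[m /not_implyP[mM nm]]; exists z; last exact: mem_cyl_restr.
move=> k hk; have [Tk Dk] := zT k hk; split=> //; apply: TT' Tk.
rewrite size_restr leqNgt; apply/negP => Mk; apply: nm.
exact/hk/(ltn_trans mM).
Qed.

(** Trees agreeing on words of length at most [N] have offspring that approximate each other to
    depth [N]. For inclusion in [U] a uniform [N] comes from compactness; for meeting [U], one point
    of the intersection supplies it. *)
Lemma offspring_continuous D : (forall t, finite_depth (size t).+1 (D t)) ->
  vietoris_continuous (fun T => offspring T D).
Proof.
move=> fD U oU.
have words M : exists F : seq (seq bool), forall s, size s <= M -> s \in F.
  exists [seq bseqval b | b <- enum {bseq M of bool}] => s sM.
  by apply/mapP; exists (Bseq sM); rewrite ?mem_enum.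
split=> T pT /= TU.
  have [N NU] := closed_sub_open_depth (offspring_closed fD) oU TU.
  have [F FM] := words N; exists F => T' pT' TT' z zT'.
  have [s sN T's|w wT zw] := offspring_approx (M := N) pT _ zT'.
    by apply/TT' => //; exact: FM.
  exact: NU wT _ (cyl_restr_sym zw).
have [z [zT /oU[N NU]]] := TU.
have [F FM] := words N; exists F => T' pT' TT'.
have [s sN Ts|w wT' zw] := offspring_approx (M := N) pT' _ zT.
  by apply/TT' => //; exact: FM.
by exists w; split=> //; exact: NU.
Qed.

(** * The clopen pieces attached to the nodes *)

Local Open Scope ring_scope.

(* The parity of the number of [1]s in [t] decides whether the piece attached
   to [t] is small or large. *)
Definition piece (t : seq bool) : set cantor :=
  let Z := cyl (nseq (size t).+1 false) in if odd (count id t) then ~` Z else Z.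

Lemma finite_depth_piece t : finite_depth (size t).+1 (piece t).
Proof.
have := @finite_depth_cyl (nseq (size t).+1 false); rewrite size_nseq /piece.
by case: odd => // h; exact: finite_depthC.
Qed.

Lemma finite_depth_cCl N A : finite_depth N A -> cCl A = A.
Proof.
move=> fA; apply/seteqP; split=> x xA; last first.
  by move=> n; exists x; split=> //; exact: mem_cyl_restr.
have [y [xy Ay]] := xA N.
by apply: fA Ay _; exact: cyl_restr_sym.
Qed.

Lemma finite_depth_cInt N A : finite_depth N A -> cInt A = A.
Proof.
move=> fA; apply/seteqP; split=> x; first by case=> n; apply; exact: mem_cyl_restr.
by move=> Ax; exists N => y; exact: fA.
Qed.

(** * Density ratios, and dualistic clopen sets *)

Lemma wt_neq0 s : wt s != 0.
Proof. by rewrite gt_eqF// wt_gt0. Qed.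

Lemma dratioE A z n :
  dratio A z n = (mu (A `&` cyl (restr z n)) * ((wt (restr z n))^-1)%:E)%E.
Proof. by rewrite /dratio mu_cyl inver (negbTE (wt_neq0 _)). Qed.

Lemma dratio_le (A : set cantor) z n (e : RR) :
  (mu (A `&` cyl (restr z n)) <= (e * wt (restr z n))%:E)%E ->
  (dratio A z n <= e%:E)%E.
Proof. by move=> h; rewrite dratioE lee_pdivrMr ?wt_gt0// -EFinM. Qed.

Lemma dratio_ge (A : set cantor) z n (e : RR) :
  (mu (~` A `&` cyl (restr z n)) <= (e * wt (restr z n))%:E)%E ->
  ((1 - e)%:E <= dratio A z n)%E.
Proof.
move=> h; rewrite dratioE lee_pdivlMr ?wt_gt0// -EFinM mulrBl mul1r EFinB.
rewrite leeBlDr// -mu_cyl -[X in mu X](setTI (cyl _)) -(setUv A) setIUl.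
exact: le_trans (le_muU _ _) (leeD2l _ h).
Qed.

Lemma dratio_ge0 A z n : (0 <= dratio A z n)%E.
Proof. by rewrite dratioE mule_ge0 ?mu_ge0// lee_fin invr_ge0 ltW// wt_gt0. Qed.

Lemma dratio_le1 A z n : (dratio A z n <= 1)%E.
Proof. by apply: dratio_le; rewrite mul1r -mu_cyl le_mu. Qed.

Lemma dratio_fin_num A z n : dratio A z n \is a fin_num.
Proof.
rewrite ge0_fin_numE ?dratio_ge0//.
exact: le_lt_trans (dratio_le1 _ _ _) (ltry _).
Qed.

Lemma density_is_near (A : set cantor) z (d : RR) :
  (forall e : RR, 0 < e -> exists N, forall n, (N <= n)%N ->
     ((d - e)%:E <= dratio A z n)%E /\ (dratio A z n <= (d + e)%:E)%E) ->
  density_is A z d.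
Proof.
move=> h; apply/fine_cvgP; split.
  by apply: nearW => n; exact: dratio_fin_num.
apply/(@cvgrPdist_le _ RR^o) => e e0; have [N hN] := h e e0.
near=> n; have [|] := hN n; first by near: n; exact: nbhs_infty_ge.
rewrite -[dratio A z n]fineK ?dratio_fin_num// !lee_fin => h1 h2.
by rewrite /= distrC ler_distl h1 h2.
Unshelve. all: by end_near. Qed.

Lemma limn_esup_eq1 (u : (\bar RR)^nat) : (forall n, u n <= 1)%E ->
  (forall (e : RR) N, 0 < e -> exists2 n, (N <= n)%N & ((1 - e)%:E <= u n)%E) ->
  limn_esup u = 1%E.
Proof.
move=> u1 hu; rewrite limn_esup_lim; suff -> : esups u = cst 1%E by exact: lim_cst.
apply/funext => N /=; apply/eqP; rewrite eq_le; apply/andP; split.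
  by apply: ge_ereal_sup => _ [n _ <-]; exact: u1.
apply/lee_addgt0Pr => e e0; have [n Nn hn] := hu e N e0.
rewrite -leeBlDr// -EFinB (le_trans hn)//.
by apply: ereal_sup_ubound; exists n.
Qed.

Lemma limn_einf_eq0 (u : (\bar RR)^nat) : (forall n, 0 <= u n)%E ->
  (forall (e : RR) N, 0 < e -> exists2 n, (N <= n)%N & (u n <= e%:E)%E) ->
  limn_einf u = 0%E.
Proof.
move=> u0 hu; rewrite limn_einf_lim; suff -> : einfs u = cst 0%E by exact: lim_cst.
apply/funext => N /=; apply/eqP; rewrite eq_le; apply/andP; split; last first.
  by apply: le_ereal_inf_tmp => _ [n _ <-]; exact: u0.
apply/lee_addgt0Pr => e e0; have [n Nn hn] := hu e N e0.
rewrite add0e (le_trans _ hn)//.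
by apply: ereal_inf_lbound; exists n.
Qed.

(** From depth [N] on, each cylinder around [z] is inside [A] or disjoint from it, according to
    whether [z] is in [A]. *)
Lemma finite_depth_dualistic N A : finite_depth N A -> dualistic A.
Proof.
move=> fA; split=> [|z]; first exact: finite_depth_measurable fA.
have [zA|zA] := pselect (A z); [right|left]; apply: density_is_near => e e0;
    exists N => n Nn; split.
- apply: dratio_ge; have [|sub|->] := finite_depth_cap (u := restr z n) (finite_depthC fA).
  + by rewrite size_restr.
  + by have := sub z (@mem_cyl_restr z n).
  + by rewrite mu0 lee_fin mulr_ge0// ltW// wt_gt0.
- by rewrite (le_trans (dratio_le1 _ _ _))// lee_fin lerDl ltW.
- by rewrite (le_trans _ (dratio_ge0 _ _ _))// lee_fin sub0r oppr_le0 ltW.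
- apply: dratio_le; have [|sub|->] := finite_depth_cap (u := restr z n) fA.
  + by rewrite size_restr.
  + by have := sub z (@mem_cyl_restr z n).
  + by rewrite mu0 add0r lee_fin mulr_ge0// ltW// wt_gt0.
Qed.

Lemma piece_compliant T : compliant T piece.
Proof.
move=> t _; have fD := @finite_depth_piece t.
have Z0 : cyl (nseq (size t).+1 false) (fun=> false) by apply/cyl_nseq.
have Z1 : ~ cyl (nseq (size t).+1 false) (fun=> true) by move=> /cyl_nseq/(_ 0%N isT).
split; first exact: finite_depth_dualistic fD.
- by rewrite /piece; case: odd; [exists (fun=> true)|exists (fun=> false)].
- rewrite /piece; case: odd => /seteqP[_ h].
    by have := h (fun=> false) I; exact.
  exact/Z1/h.
- by rewrite (finite_depth_cInt fD) (finite_depth_cCl fD).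
Qed.

(** * Mass near a stretched branch *)

(** Independence of the bits from [L] on: halve [cyl u] until its word has length [L], where [E] is
    confined to the cylinder of [u ++ v]. *)
Lemma mu_tail (E : set cantor) u v L : (size u <= L)%N ->
  (forall x, E x -> cyl v (drop_inf L x)) ->
  (mu (E `&` cyl u) <= (wt u * wt v)%:E)%E.
Proof.
move=> uL Ev; elim: {u}(L - size u)%N {-2}u (erefl (L - size u)%N) uL => [|m IH] u um uL.
  rewrite -wt_cat -mu_cyl le_mu// => x [Ex ux].
  have uLE : size u = L by apply/eqP; rewrite eqn_leq uL -subn_eq0 um.
  by apply/(cyl_shift _ _ uLE); split=> //; exact: Ev.
have {}uL : (size u < L)%N by rewrite -subn_gt0 um.
apply: mu_half => b; rewrite mulrAC -(wt_rcons u b); apply: IH; rewrite size_rcons//.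
by rewrite subnS um.
Qed.

(* [E] stands for the offspring or for its complement, whichever is small
   along the stretch of [x]. *)
Definition thin_at (E : set cantor) (x : cantor) k :=
  forall z, E z -> cyl (stretch (restr x k)) z ->
    const_block z k \/ cyl (nseq k.+1 false) (drop_inf (tri k.+1) z).

Local Notation half_pow n := (2%:R ^- n : RR).

Lemma wt_restr (z : cantor) n : wt (restr z n) = half_pow n.
Proof. by rewrite /wt size_restr. Qed.

Lemma wt_nseq n b : wt (nseq n b) = half_pow n.
Proof. by rewrite /wt size_nseq. Qed.

Lemma exp2NS n : half_pow n.+1 = half_pow n / 2.
Proof. by rewrite exprS invfM mulrC. Qed.

Lemma exp2N_gt0 n : 0 < half_pow n.
Proof. by rewrite invr_gt0 exprn_gt0. Qed.

Lemma le_exp2N_anti m n : (m <= n)%N -> half_pow n <= half_pow m.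
Proof. by move=> mn; rewrite lef_pV2 ?posrE ?exprn_gt0// ler_weXn2l// ler1n. Qed.

(** Relative to the cylinder, the two constant blocks have mass [2^-k] and the tails starting with
    [k + 1] zeros have mass [2^-(k+1)], whence the factor [3/2]. *)
Lemma mu_thin E x k : thin_at E x k ->
  (mu (E `&` cyl (restr (stretch_inf x) (tri k))) <=
    (3 / 2 * half_pow k * half_pow (tri k))%:E)%E.
Proof.
move=> thin; rewrite restr_stretch_inf; set u := stretch _.
have su : size u = tri k by rewrite size_stretch size_restr.
pose E1 : set cantor := [set z | cyl (nseq k.+1 false) (drop_inf (tri k.+1) z)].
have sub : E `&` cyl u `<=` E1 `&` cyl u `|`
    (cyl (u ++ nseq k.+1 false) `|` cyl (u ++ nseq k.+1 true)).
  move=> z [Ez uz]; have [cz|] := thin z Ez uz; last by left.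
  right; case zb : (z (tri k)); [right|left]; apply/(cyl_shift _ _ su); split=> //;
    by apply/cyl_nseq => i ik; rewrite cz.
apply: le_trans (le_mu sub) _; apply: le_trans (le_muU _ _) _.
have h1 : (mu (E1 `&` cyl u) <= (half_pow (tri k) * half_pow k.+1)%:E)%E.
  have := @mu_tail E1 u (nseq k.+1 false) (tri k.+1).
  rewrite wt_nseq /u -restr_stretch_inf wt_restr; apply => //.
  by rewrite size_restr leq_addr.
apply: le_trans (leeD h1 (le_muU _ _)) _.
have wtu : wt u = half_pow (tri k) by rewrite /wt su.
rewrite !mu_cyl !wt_cat !wt_nseq wtu -!EFinD lee_fin exp2NS; lra.
Qed.

(** The level [(tri k + j).+1] reads at least one bit of block [k], so a constant block must repeat
    [x k] and lead into the cylinder of the next block, where [mu_thin] applies. The relative masses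
    [2^-k / 2] and [3/4 * 2^-k] add up to less than [2 * 2^-k]. *)
Lemma mu_thin2 E x k j : thin_at E x k -> thin_at E x k.+1 -> (j <= k)%N ->
  (mu (E `&` cyl (restr (stretch_inf x) (tri k + j).+1%N)) <=
    (2 * half_pow k * half_pow (tri k + j).+1%N)%:E)%E.
Proof.
move=> thin /mu_thin thin1 jk; set n := (tri k + j).+1%N.
pose E1 : set cantor := [set z | cyl (nseq k.+1 false) (drop_inf (tri k.+1) z)].
have nk : (n <= tri k.+1)%N by rewrite ltn_tri_block.
have sub : E `&` cyl (restr (stretch_inf x) n) `<=`
    E1 `&` cyl (restr (stretch_inf x) n) `|`
    E `&` cyl (restr (stretch_inf x) (tri k.+1)).
  move=> z [Ez /cyl_restr xz].
  have uz : cyl (stretch (restr x k)) z.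
    rewrite -restr_stretch_inf; apply/cyl_restr => i ik; apply: xz.
    by rewrite /n ltnS (leq_trans (ltnW ik))// leq_addr.
  have [cz|zE] := thin z Ez uz; last by left; split=> //; exact/cyl_restr.
  right; split=> //; apply/cyl_restr => i; rewrite /= => ik.
  have [ki|ki] := ltnP i (tri k).+1.
    by apply: xz; rewrite (leq_trans ki)// ltnS leq_addr.
  have [l il] : exists l, i = (tri k + l)%N by exists (i - tri k)%N; rewrite subnKC// ltnW.
  move: ik ki; rewrite il ltn_add2l ltnS => lk _.
  rewrite cz// stretch_infE// -[tri k]addn0 xz ?stretch_infE//.
  by rewrite /n addn0 ltnS leq_addr.
apply: le_trans (le_mu sub) _; apply: le_trans (le_muU _ _) _.
have h1 : (mu (E1 `&` cyl (restr (stretch_inf x) n)) <= (half_pow n * half_pow k.+1)%:E)%E.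
  have := @mu_tail E1 (restr (stretch_inf x) n) (nseq k.+1 false) (tri k.+1).
  by rewrite wt_nseq wt_restr; apply => //; rewrite size_restr.
apply: le_trans (leeD h1 thin1) _.
rewrite -EFinD lee_fin (exp2NS k).
have := le_exp2N_anti nk; have := exp2N_gt0 k; have := exp2N_gt0 n.
set a := half_pow n; set b := half_pow k; set c := half_pow (tri k.+1) => a0 b0 ca.
have : b * c <= b * a by rewrite ler_pM2l.
have : 0 < b * a by rewrite mulr_gt0.
lra.
Qed.

(** At an odd node the piece is the complement of the zero cylinder, so it is the complement of the
    offspring whose tails lie in that cylinder. *)
Lemma thin_offspring T x : pruned_tree T -> branches T x ->
  let G := offspring T piece in
  let E k := if odd (count id (restr x k)) then ~` G else G in
  forall k, thin_at (E k) x k.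
Proof.
move=> [_ sT _] Tx G E k z; rewrite /E => Ez uz.
have [cz|nz] := pselect (const_block z k); [by left|right].
have := offspring_node piece sT (Tx k) uz; rewrite size_restr => /(_ nz) h.
move: Ez; case: ifP => par; rewrite /= ?/G.
  move=> nG; apply: contrapT => nZ; apply: nG; apply/h.
  by rewrite /piece par size_restr.
by move/h; rewrite /piece par size_restr.
Qed.

(** * Parity along a branch, oscillation and density *)

Lemma odd_count_restrS (x : cantor) n :
  odd (count id (restr x n.+1)) = odd (count id (restr x n)) (+) x n.
Proof. by rewrite restrS -cats1 count_cat oddD /= addn0 oddb. Qed.

(** Reading a one flips the parity, so both parities occur around it. *)
Lemma Ninf_parity x b N : Ninf x ->
  exists2 k, (N <= k)%N & odd (count id (restr x k)) = b.
Proof.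
move=> /(_ N)[n Nn xn]; have [<-|nb] := eqVneq (odd (count id (restr x n))) b.
  by exists n.
exists n.+1; first exact: leqW.
by rewrite odd_count_restrS xn addbT; case: b nb; case: odd.
Qed.

Lemma not_Ninf_parity x : ~ Ninf x ->
  exists m, forall k, (m <= k)%N ->
    odd (count id (restr x k)) = odd (count id (restr x m)).
Proof.
move=> /existsNP[m hm]; exists m => k mk.
elim: k mk => [|k IH]; first by rewrite leqn0 => /eqP->.
rewrite leq_eqVlt => /orP[/eqP <-//|mk]; rewrite odd_count_restrS IH//.
case xk : (x k); last by rewrite addbF.
by exfalso; apply: hm; exists k.
Qed.

(** At the levels [tri k], odd parity brings the ratio near 1 and even parity near 0; both recur
    forever, so the limsup is 1 and the liminf 0. *)
Lemma oscillation_offspring T x : pruned_tree T -> branches T x -> Ninf x ->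
  oscillation (offspring T piece) (stretch_inf x) = 1%E.
Proof.
move=> pT Tx xN; set G := offspring T piece; rewrite /oscillation.
have key b (e : RR) N : 0 < e -> exists2 n, (N <= n)%N &
    (mu ((if b then ~` G else G) `&` cyl (restr (stretch_inf x) n)) <=
      (e * wt (restr (stretch_inf x) n))%:E)%E.
  move=> e0; have [m me] := le_exp2N (divr_gt0 e0 (ltr0Sn _ 1)).
  have [k mk <-] := Ninf_parity b (maxn N m) xN.
  exists (tri k); first by rewrite (leq_trans _ (leq_tri k))// (leq_trans (leq_maxl _ _) mk).
  apply: le_trans (mu_thin (thin_offspring pT Tx (k := k))) _.
  rewrite wt_restr lee_fin ler_pM2r ?exp2N_gt0//.
  have := le_exp2N_anti (leq_trans (leq_maxr N m) mk).
  lra.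
rewrite (limn_esup_eq1 (dratio_le1 G _)); last first.
  move=> e N e0; have [n Nn hn] := key true e N e0.
  by exists n => //; exact: dratio_ge.
rewrite (limn_einf_eq0 (dratio_ge0 G _)) ?sube0// => e N e0.
have [n Nn hn] := key false e N e0.
by exists n => //; exact: dratio_le.
Qed.

Lemma density_offspring T x : pruned_tree T -> branches T x -> ~ Ninf x ->
  density_is (offspring T piece) (stretch_inf x) 0 \/
  density_is (offspring T piece) (stretch_inf x) 1.
Proof.
set G := offspring T piece => pT Tx /not_Ninf_parity[m]; set b := odd _ => hm.
have thin k : (m <= k)%N -> thin_at (if b then ~` G else G) x k.
  by move=> /hm <-; exact: thin_offspring.
have key (e : RR) : 0 < e -> exists N, forall n, (N <= n)%N ->
    (mu ((if b then ~` G else G) `&` cyl (restr (stretch_inf x) n)) <=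
      (e * wt (restr (stretch_inf x) n))%:E)%E.
  (* Taking [2^-l] at most [e / 2] absorbs the factor 2 of [mu_thin2]. *)
  move=> e0; have [l le] := le_exp2N (divr_gt0 e0 (ltr0Sn _ 1)).
  (* The successor excludes level 0, so that every level has the form [(tri k + j).+1], with [k] at
     least [m] and [l]. *)
  exists (tri (maxn m l)).+1 => -[//|n]; rewrite ltnS.
  have [k [j [jk ->]]] := tri_block n => mn.
  have mk : (maxn m l <= k)%N.
    rewrite leqNgt; apply/negP => /leq_triS km.
    by have := leq_trans (leq_trans (ltn_tri_block jk) km) mn; rewrite ltnn.
  rewrite geq_max in mk; case/andP: mk => mk lk.
  apply: le_trans (mu_thin2 (thin _ mk) (thin _ (leqW mk)) jk) _.
  rewrite wt_restr lee_fin ler_pM2r ?exp2N_gt0//.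
  have := le_exp2N_anti lk.
  lra.
case: b {thin hm} key => key; [right|left]; apply: density_is_near => e e0;
    have [N hN] := key e e0; exists N => n /hN; split.
- exact: dratio_ge.
- by rewrite (le_trans (dratio_le1 _ _ _))// lee_fin lerDl ltW.
- by rewrite (le_trans _ (dratio_ge0 _ _ _))// lee_fin sub0r oppr_le0 ltW.
- by rewrite add0r; exact: dratio_le.
Qed.

Theorem theorem4p2 :
  exists G : set (seq bool) -> set cantor,
    vietoris_continuous G /\
    forall T, pruned_tree T ->
      [/\ cclosed (G T),
          (exists D, compliant T D /\ G T = closed_offspring T D) &
          (forall x, branches T x ->
             (Ninf x -> oscillation (G T) (stretch_inf x) = 1%E) /\
             (~ Ninf x -> density_is (G T) (stretch_inf x) 0
                          \/ density_is (G T) (stretch_inf x) 1))].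
Proof.
exists (fun T => offspring T piece); split.
  exact/offspring_continuous/finite_depth_piece.
move=> T pT; split; first exact/offspring_closed/finite_depth_piece.
  exists piece; split; first exact: piece_compliant.
  by rewrite offspringE// => t; apply: finite_depth_cCl; exact: finite_depth_piece.
move=> x Tx; split; first exact: oscillation_offspring.
exact: density_offspring.
Qed.
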